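(* For every $d,k,N\in\mathbb{N}$ (positive integers), the barycenter map $\mathsf{bary}:\mathcal{G}_{d,k}^N\to\mathcal{G}_{d,k}$ is an epimorphism (surjective morphism) of real affine algebraic varieties. Moreover, if $N-1$ of the $N$ sample elements are fixed arbitrarily, then the resulting map $\mathcal{G}_{d,k}\to\mathcal{G}_{d,k}$ (in the remaining sample element) is an isomorphism of algebraic varieties.
   Context: Let $T_{d,k}=\bigoplus_{\ell=0}^k(\mathbb{R}^d)^{\otimes \ell}$ be the truncated tensor algebra; write its elements as $\mathbf{z}=\mathbf{z}^{(0)}\oplus\cdots\oplus\mathbf{z}^{(k)}$ with $\mathbf{z}^{(\ell)}\in(\mathbb{R}^d)^{\otimes\ell}$. The product is the bilinear extension of $(\mathbf{a}\otimes\mathbf{b})_{i_1\dots i_{\ell+n}}=\mathbf{a}_{i_1\dots i_\ell}\mathbf{b}_{i_{\ell+1}\dots i_{\ell+n}}$ for $\mathbf{a}\in(\mathbb{R}^d)^{\otimes\ell},\mathbf{b}\in(\mathbb{R}^d)^{\otimes n}$ when $\ell+n\le k$, and $0$ when $\ell+n>k$; the unit is $1\in(\mathbb{R}^d)^{\otimes 0}=\mathbb{R}$. Let $\mathfrak{g}_{d,k}$ be the smallest Lie subalgebra of $T_{d,k}$ (bracket $[\mathbf{y},\mathbf{z}]=\mathbf{y}\otimes\mathbf{z}-\mathbf{z}\otimes\mathbf{y}$) containing the standard basis vectors $e_1,\dots,e_d\in\mathbb{R}^d$ (in level $1$). Let $\exp(\mathbf{z})=\sum_{\ell=0}^k\frac{1}{\ell!}\mathbf{z}^{\otimes\ell}$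 and $\mathcal{G}_{d,k}=\exp(\mathfrak{g}_{d,k})$, a group under the product of $T_{d,k}$ (the free nilpotent Lie group); $\exp:\mathfrak{g}_{d,k}\to\mathcal{G}_{d,k}$ is bijective with inverse $\log(\mathbf{s})=\sum_{\ell\ge1}\frac{(-1)^{\ell+1}}{\ell}(\mathbf{s}-1)^{\otimes\ell}$ (a finite sum). $\mathfrak{g}_{d,k}$ and $\mathcal{G}_{d,k}$ are regarded as real affine algebraic subvarieties of $T_{d,k}\cong\mathbb{R}^{(d^{k+1}-1)/(d-1)}$. For a sample $\mathbf{x}=(\mathbf{x}_1,\dots,\mathbf{x}_N)\in\mathcal{G}_{d,k}^N$, its barycenter $\mathsf{bary}(\mathbf{x})$ is the unique $\mathbf{m}\in\mathcal{G}_{d,k}$ satisfying $\sum_{i=1}^N\log(\mathbf{m}^{-1}\cdot\mathbf{x}_i)=0$ (existence and uniqueness are known). *)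

(* Defs.v *)
From HB Require Import structures.
From mathcomp Require Import all_boot all_order all_algebra.
From mathcomp Require Import Rstruct.
From Stdlib Require Reals.
From Stdlib Require Import ClassicalEpsilon.
Notation R := Rdefinitions.R.
Set Implicit Arguments. Unset Strict Implicit. Unset Printing Implicit Defensive.
Import Order.TTheory GRing.Theory Num.Theory.
Local Open Scope ring_scope.

(* An element of the truncated tensor algebra T_{d,k} is represented by its
   coordinates: z w is the coefficient of the word w = (i_1 .. i_l) (i.e. the
   entry z^{(l)}_{i_1...i_l}).  Only words of length <= k are meaningful;
   [inT k z] says that z has no coefficient beyond level k. *)
Definition tensor (d : nat) := seq 'I_d -> R.

Section Tensor.
Variables (d k : nat).

Definition inT (z : tensor d) : Prop := forall w, (k < size w)%N -> z w = 0.

Definition tzero : tensor d := fun _ => 0.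
Definition tone : tensor d := fun w => if w == [::] then 1 else 0.
Definition tadd (a b : tensor d) : tensor d := fun w => a w + b w.
Definition tscale (c : R) (a : tensor d) : tensor d := fun w => c * a w.
Definition topp (a : tensor d) : tensor d := tscale (-1) a.
Definition tsub (a b : tensor d) : tensor d := tadd a (topp b).
Definition tbasis (i : 'I_d) : tensor d := fun w => if w == [:: i] then 1 else 0.

Definition tmul (a b : tensor d) : tensor d := fun w =>
  if (size w <= k)%N then \sum_(i < (size w).+1) a (take i w) * b (drop i w)
  else 0.

Definition tbracket (y z : tensor d) : tensor d := tsub (tmul y z) (tmul z y).

Fixpoint tpow (z : tensor d) (l : nat) : tensor d :=
  match l with 0 => tone | l'.+1 => tmul z (tpow z l') end.

Definition tsum (n : nat) (F : nat -> tensor d) : tensor d :=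
  fun w => \sum_(l < n) F l w.

Definition texp (z : tensor d) : tensor d :=
  tsum k.+1 (fun l => tscale (l`!%:R)^-1 (tpow z l)).

(* log(s) = sum_{l>=1} (-1)^{l+1}/l (s-1)^{(x) l}; terms with l > k vanish
   for s with s^{(0)} = 1 *)
Definition tlog (s : tensor d) : tensor d :=
  tsum k.+1 (fun l => if l == 0%N then tzero
                      else tscale ((-1) ^+ l.+1 / l%:R) (tpow (tsub s tone) l)).

(* inverse in T_{d,k} of s with s^{(0)} = 1 (e.g. s in G_{d,k}):
   s^{-1} = sum_{l=0}^k (1 - s)^{(x) l} *)
Definition tinv (s : tensor d) : tensor d :=
  tsum k.+1 (fun l => tpow (tsub tone s) l).

Definition lie_subalgebra (S : tensor d -> Prop) : Prop :=
  [/\ forall z, S z -> inT z,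
      S tzero,
      forall y z, S y -> S z -> S (tadd y z),
      forall c z, S z -> S (tscale c z) &
      forall y z, S y -> S z -> S (tbracket y z)].

Definition in_g (z : tensor d) : Prop :=
  forall S, lie_subalgebra S -> (forall i, S (tbasis i)) -> S z.

Definition in_G (s : tensor d) : Prop := exists z, in_g z /\ s = texp z.

Definition is_bary (N : nat) (x : 'I_N -> tensor d) (m : tensor d) : Prop :=
  in_G m /\ (fun w => \sum_(i < N) tlog (tmul (tinv m) (x i)) w) = tzero.

Definition bary (N : nat) (x : 'I_N -> tensor d) : tensor d :=
  epsilon (inhabits tzero) (is_bary x).

(* Real polynomial functions on a real vector space X given by a family C of
   coordinate functions: the R-algebra of functions generated by C. *)
Inductive polyfun (X : Type) (C : (X -> R) -> Prop) : (X -> R) -> Prop :=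
| pf_coord f : C f -> polyfun C f
| pf_const (c : R) : polyfun C (fun _ => c)
| pf_add f g : polyfun C f -> polyfun C g -> polyfun C (fun x => f x + g x)
| pf_mul f g : polyfun C f -> polyfun C g -> polyfun C (fun x => f x * g x).

Definition coordT (f : tensor d -> R) : Prop :=
  exists w, (size w <= k)%N /\ f = (fun z => z w).
Definition coordTN (N : nat) (f : ('I_N -> tensor d) -> R) : Prop :=
  exists i w, (size w <= k)%N /\ f = (fun x => x i w).

(* F : X -> T_{d,k} is a morphism on the variety D (subset of the ambient real
   affine space X with coordinates C) into the variety E: F maps D into E and
   agrees on D with a polynomial map (each coordinate of the target is a real
   polynomial in the coordinates of the source). *)
Definition morphism_on (X : Type) (C : (X -> R) -> Prop) (D : X -> Prop)
    (E : tensor d -> Prop) (F : X -> tensor d) : Prop :=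
  (forall x, D x -> E (F x)) /\
  forall w, (size w <= k)%N ->
    exists p, polyfun C p /\ forall x, D x -> F x w = p x.

Definition in_GN (N : nat) (x : 'I_N -> tensor d) : Prop := forall i, in_G (x i).

End Tensor.

(* Main.v *)
(** The grading derivation [D] multiplies level [n] by [n]. For every derivation,
[exp(-Z) D(exp Z) = sum_m (-1)^m/(m+1)! ad_Z^m (D Z)]. Applied to [D] and to inner
derivations, this shows that [w = exp(-Z) D(exp Z)] is a Lie element whenever
[exp Z = exp a exp b] with [a], [b] Lie elements; conversely [D Z] equals [w] up to
brackets with [Z], so [Z] is a Lie element level by level, and G is a group.

The map [m |-> m exp (1/N sum_i log (m^-1 x_i))] sends G to G, its fixed points are the
barycenters, and it gains one level of agreement at each application: the linear part
of [log (m^-1 x_i)] in [m] is [- m]. Hence the barycenter exists, is unique, and is the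
[k+1]-st iterate at [1], which is polynomial in [x]. Finally, the barycenter equation is
solved for [x_j] by [x_j = m exp (- sum_(i <> j) log (m^-1 x_i))], which gives the
inverse of the partial map. *)

Require Import Defs.
From HB Require Import structures.
From mathcomp Require Import all_boot all_order all_algebra.
From mathcomp Require Import ring.
From mathcomp Require Import boolp Rstruct.
From Stdlib Require Reals.
Set Implicit Arguments. Unset Strict Implicit. Unset Printing Implicit Defensive.
Import Order.TTheory GRing.Theory Num.Theory.
Local Open Scope ring_scope.

(** * Truncated exponential and logarithm *)

Section ExpLog.
Variables (K : numFieldType) (A : algType K) (k : nat).

Definition expt (z : A) : A := \sum_(l < k.+1) (l`!%:R^-1 : K) *: z ^+ l.

(* The term [l = 0] vanishes because [0^-1 = 0]. *)
Definition logt (s : A) : A :=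
  \sum_(l < k.+1) ((-1) ^+ l.+1 / l%:R : K) *: (s - 1) ^+ l.

Definition invt (s : A) : A := \sum_(l < k.+1) (1 - s) ^+ l.

Lemma mulr_invt (s : A) : (1 - s) ^+ k.+1 = 0 -> s * invt s = 1.
Proof.
move=> s0; have := subrX1 (1 - s) k.+1; rewrite s0 sub0r -/(invt s) => h.
by apply: oppr_inj; rewrite h addrAC subrr add0r mulNr.
Qed.

Lemma invt_mulr (s : A) : (1 - s) ^+ k.+1 = 0 -> invt s * s = 1.
Proof.
move=> s0; rewrite -[RHS](mulr_invt s0) /invt mulr_suml mulr_sumr.
apply: eq_bigr => l _; apply/commr_sym/commrX.
by rewrite /GRing.comm mulrBl mulrBr mulr1 mul1r.
Qed.

(** Identities between truncated series are proved once in one variable, modulo ['X^n], and then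
    carried to every nilpotent element of every algebra. *)
Lemma horner_alg_trunc (n : nat) (a : A) (p q : {poly K}) :
  a ^+ n = 0 -> (forall i, (i < n)%N -> p`_i = q`_i) ->
  horner_alg a p = horner_alg a q.
Proof.
move=> a0 pq; rewrite -[p](poly_take_drop n) -[q](poly_take_drop n).
have -> : take_poly n p = take_poly n q.
  by apply/polyP => i; rewrite !coef_take_poly; case: ifP => // /pq.
by rewrite !rmorphD !rmorphM /= !rmorphXn /= horner_algX a0 !mulr0.
Qed.

End ExpLog.

(** * Exponential and logarithm identities for polynomials in one variable *)

Section ExpLogPoly.
Variables (K : numFieldType) (k : nat).
Implicit Types p q : {poly K}.

Lemma deriv_expt p :
  (expt k p)^`() = p^`() * (expt k p - (k`!%:R^-1 : K) *: p ^+ k).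
Proof.
rewrite /expt [in RHS]big_ord_recr /= addrK.
rewrite linear_sum /= big_ord_recl /= expr0 derivZ -polyC1 derivC scaler0 add0r.
rewrite mulr_sumr.
apply: eq_bigr => i _.
rewrite derivZ deriv_exp /= /bump /= add1n factS -mulrnAr -scaler_nat.
rewrite -!scalerAr scalerA; congr (_ *: _).
rewrite natrM invfM mulrAC mulVf ?mul1r //.
by rewrite pnatr_eq0.
Qed.

Lemma coef_mulXn_lt n p q i : (i < n)%N -> (p * (q * 'X^n))`_i = 0.
Proof. by move=> h; rewrite mulrA coefMXn h. Qed.

Lemma coef0_expt p : p`_0 = 0 -> (expt k p)`_0 = 1.
Proof.
move=> p0; rewrite /expt coef_sum big_ord_recl big1 => [|i _].
  by rewrite addr0 coefZ coef1 fact0 invr1 mulr1.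
rewrite coefZ; apply/eqP; rewrite mulf_eq0; apply/orP; right; apply/eqP.
have -> : p ^+ lift ord0 i = p * p ^+ i by rewrite -exprS.
by rewrite coef0M p0 mul0r.
Qed.

(** By [deriv_expt] the derivative of the product consists of truncation errors only, which are
    multiples of ['X^k]; in characteristic zero the coefficients in degrees [1] to [k] therefore
    vanish. *)
Lemma expt_oppX_coef i : (i <= k)%N ->
  (expt k ('X : {poly K}) * expt k (- 'X))`_i = (1 : {poly K})`_i.
Proof.
case: i => [_|i ik].
  rewrite coef0M !coef0_expt ?mul1r ?coef1 ?coefX ?coefN ?coefX ?oppr0 //.
have : ((expt k ('X : {poly K}) * expt k (- 'X))^`())`_i = 0.
  rewrite derivM !deriv_expt derivN derivX mul1r mulN1r.
  set e := expt k _; set f := expt k _.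
  rewrite (_ : _ + _ = - ((k`!%:R^-1 : K) *: f * (1 * 'X^k))
     + ((-1) ^+ k * (k`!%:R^-1 : K)) *: e * (1 * 'X^k)).
    by rewrite coefD coefN !coef_mulXn_lt // oppr0 addr0.
  rewrite (exprNn 'X) -!mul_polyC !polyCM rmorphXn /= rmorphN1; ring.
rewrite coef_deriv coef1 /= => /eqP; rewrite mulrn_eq0 /= => /eqP //.
Qed.

(** The truncated series of [log (1 + X)]. *)
Let L : {poly K} := \sum_(l < k.+1) ((-1) ^+ l.+1 / l%:R : K) *: 'X ^+ l.

(** Modulo ['X^k], [E = exp L] solves [(1 + X) E' = E], that is [(j+1) E_(j+1) = (1 - j) E_j]. With
    [E_0 = 1] this forces the coefficients [1, 1, 0, 0, ...]. *)
Lemma coef_expt_logX i : (i <= k)%N -> (expt k L)`_i = (1 + 'X : {poly K})`_i.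
Proof.
have L0 : L`_0 = 0.
  rewrite /L coef_sum big1 // => -[[|j] jk] _ /=; rewrite coefZ coefXn /=.
    by rewrite invr0 mulr0 mul0r.
  by rewrite mulr0.
(* Divisibility by ['X] turns the error term [L ^+ k] of [deriv_expt] into a multiple of ['X^k]. *)
have [r Lr] : exists r, L = r * 'X.
  exists (drop_poly 1 L); rewrite -{1}[L](poly_take_drop 1) expr1.
  suff -> : take_poly 1 L = 0 by rewrite add0r.
  by apply/polyP => -[|j]; rewrite coef_take_poly coef0 // L0.
have dL : (1 + 'X) * L^`() = 1 - (- 'X) ^+ k.
  have -> : L^`() = \sum_(l < k) (- 'X) ^+ l.
    rewrite /L linear_sum /= big_ord_recl /= derivZ derivXn mulr0n scaler0 add0r.
    apply: eq_bigr => l _; rewrite derivZ derivXn /bump /= add1n /= -scaler_nat.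
    rewrite scalerA -mulrA mulVf ?pnatr_eq0 // mulr1 !exprS mulrA mulrNN mulr1 mul1r.
    by rewrite (exprNn 'X) -mul_polyC rmorphXn rmorphN1.
  have := subrX1 (- 'X : {poly K}) k => h.
  by rewrite -[RHS]opprB h -mulNr opprB opprK.
set E := expt k L.
have dE : (1 + 'X) * E^`() =
    E - (((- 1) ^+ k *: E + (1 - (- 'X) ^+ k) * ((k`!%:R^-1 : K) *: r ^+ k)) * 'X^k).
  rewrite deriv_expt mulrA dL -/E Lr exprMn (exprNn 'X) -!mul_polyC rmorphXn rmorphN1.
  ring.
have rec j : (j < k)%N -> E`_j.+1 *+ j.+1 + (if j == 0%N then 0 else E`_j *+ j) = E`_j.
  move=> jk; have := congr1 (fun p : {poly K} => p`_j) dE.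
  rewrite mulrDl mul1r coefD coefXM !coef_deriv coefB.
  rewrite coefMXn jk subr0 => h; rewrite -[RHS]h.
  by case: (j) => //= j'; rewrite coef_deriv.
have E0 : E`_0 = 1 by apply: coef0_expt.
elim: i => [|i IH] ik; first by rewrite E0 coefD coef1 coefX addr0.
have := rec i ik; rewrite (IH (ltnW ik)).
rewrite !coefD !coef1 !coefX /=; case: i ik {IH} => [|i] ik /=.
  by rewrite mulr1n !addr0 add0r => ->.
rewrite !add0r eqSS; case: i ik => [|i] ik /=.
  rewrite mulr1n => h; have /eqP : E`_2 *+ 2 = 0 by rewrite -[LHS](addrK 1) h subrr.
  by rewrite mulrn_eq0 /= => /eqP.
by move/eqP; rewrite mul0rn addr0 mulrn_eq0 /= => /eqP.
Qed.

End ExpLogPoly.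

Section ExpLogNilp.
Variables (K : numFieldType) (A : algType K) (k : nat).
Implicit Types z s : A.

Lemma horner_alg_expt z (p : {poly K}) :
  horner_alg z (expt k p) = expt k (horner_alg z p).
Proof.
rewrite rmorph_sum; apply: eq_bigr => l _.
by rewrite /= linearZ /= rmorphXn mulr_algl.
Qed.

Lemma exptN_mul z : z ^+ k.+1 = 0 -> expt k z * expt k (- z) = 1.
Proof.
move=> z0; have := horner_alg_trunc z0 (@expt_oppX_coef K k).
by rewrite rmorphM /= !horner_alg_expt rmorphN /= !horner_algX rmorph1.
Qed.

Lemma logtK s : (s - 1) ^+ k.+1 = 0 -> expt k (logt k s) = s.
Proof.
move=> s0; have := horner_alg_trunc s0 (@coef_expt_logX K k).
rewrite horner_alg_expt rmorph_sum /= rmorphD /= rmorph1 horner_algX addrCA subrr addr0.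
move=> {2}<-; congr expt; apply: eq_bigr => l _.
by rewrite linearZ /= rmorphXn /= horner_algX mulr_algl.
Qed.

Lemma expt0 : expt k (0 : A) = 1.
Proof.
rewrite /expt big_ord_recl big1 => [|i _]; last by rewrite expr0n /= scaler0.
by rewrite addr0 fact0 invr1 scale1r.
Qed.

Lemma logt1 : logt k (1 : A) = 0.
Proof.
rewrite /logt big1 // => -[[|l] lk] _ /=; first by rewrite invr0 mulr0 scale0r.
by rewrite subrr expr0n scaler0.
Qed.

End ExpLogNilp.

(** * Logarithmic derivative of the exponential *)

Section LogDerivative.
Variables (K : numFieldType) (A : algType K).

Definition ad (z y : A) : A := z * y - y * z.

Variable D : {linear A -> A}.
Hypothesis DM : forall a b, D (a * b) = D a * b + a * D b.

Lemma derivation1 : D 1 = 0.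
Proof.
by have := DM 1 1; rewrite !mulr1 mul1r => /eqP; rewrite -subr_eq0 opprD addNKr oppr_eq0 => /eqP.
Qed.

(** The Leibniz rule leaves powers of [z] on both sides of [D z]. Moving the right ones to the left
    costs one bracket each, and Pascal's rule counts the results. *)
Lemma derivation_expr (z : A) n :
  D (z ^+ n) = \sum_(m < n) ((-1) ^+ m * 'C(n, m.+1)%:R : K) *:
    (z ^+ (n - m.+1) * iter m (ad z) (D z)).
Proof.
elim: n => [|n IH]; first by rewrite big_ord0 expr0 derivation1.
set a := fun m => iter m (ad z) (D z).
have az m : a m * z = z * a m - a m.+1 by rewrite /a /= /ad opprB addrC subrK.
have -> : D (z ^+ n.+1) = D (z ^+ n) * z + z ^+ n * a 0%N by rewrite exprSr DM.
rewrite IH mulr_suml.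
under eq_bigr => m _ do
  rewrite -scalerAl -mulrA -/(a m) az mulrBr scalerBr mulrA -exprSr subnSK //.
under [RHS]eq_bigr => m _ do rewrite -/(a m) subSS binS natrD mulrDr scalerDl.
rewrite sumrB !big_split /= big_ord_recr /= bin_small // mulr0 scale0r addr0.
rewrite -addrA; congr (_ + _).
rewrite big_ord_recl /= subn0 expr0 bin0 mulr1 scale1r addrC; congr (_ + _).
rewrite -sumrN; apply: eq_bigr => m _.
by rewrite /bump /= add1n exprS mulN1r mulNr scaleNr.
Qed.

(** With [p = n - m] the double sum runs over a triangle of terms [F p m], while the product on the
    right runs over a rectangle; the hypothesis kills exactly the terms outside the triangle. *)
Lemma derivation_expt (k : nat) (z : A) :
  (forall p m, (k <= p + m)%N -> z ^+ p * iter m (ad z) (D z) = 0) ->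
  D (expt k z) = expt k z *
    \sum_(m < k) ((-1) ^+ m / m.+1`!%:R : K) *: iter m (ad z) (D z).
Proof.
move=> nil; set a := fun m => iter m (ad z) (D z).
pose F p m := (p`!%:R^-1 * ((-1) ^+ m / m.+1`!%:R) : K) *: (z ^+ p * a m).
have F0 p m : (k <= p + m)%N -> F p m = 0 by move=> /nil h; rewrite /F h scaler0.
have -> : D (expt k z) = \sum_(0 <= n < k) \sum_(0 <= m < k | (m <= n)%N) F (n - m)%N m.
  rewrite /expt linear_sum big_ord_recl /= linearZ /= derivation1 scaler0 add0r.
  rewrite big_mkord; apply: eq_bigr => n _.
  rewrite linearZ /= derivation_expr scaler_sumr big_mkord.
  rewrite (big_ord_widen k (fun m => ((bump 0 n)`!%:R^-1 : K) *:
    (((-1) ^+ m * 'C(bump 0 n, m.+1)%:R : K) *: (z ^+ (bump 0 n - m.+1) * a m))));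
    last exact: ltn_ord.
  apply: eq_big => m //=; rewrite /bump /= add1n /= => mn.
  rewrite /F scalerA mulrCA [in RHS]mulrCA; congr (_ * _ *: _).
  (* ['C(n+1, m+1) / (n+1)! = 1 / ((m+1)! (n-m)!)] separates the two exponential-type
     coefficients. *)
  rewrite -(bin_fact (_ : m.+1 <= n.+1)%N) // subSS.
  rewrite (natrM _ 'C(_, _)) (natrM _ m.+1`!) invfM mulrAC mulVf ?mul1r ?invfM 1?mulrC //.
  by rewrite pnatr_eq0 -lt0n bin_gt0.
rewrite (exchange_big_dep xpredT) //= /expt mulr_suml.
under [RHS]eq_bigr => p _ do rewrite mulr_sumr.
rewrite exchange_big big_mkord /=; apply: eq_bigr => m _.
under [RHS]eq_bigr => p _ do rewrite -scalerAr -scalerAl scalerA mulrC -/(a m) -/(F p m).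
rewrite -(big_mkord xpredT (fun p => F p m)).
rewrite [RHS](big_cat_nat (n := (k - m)%N)) //=; last by apply: leqW; apply: leq_subr.
rewrite [X in _ + X]big_nat_cond [X in _ + X]big1 ?addr0; last first.
  by move=> p /andP[/andP[h _] _]; apply: F0; rewrite addnC -leq_subLR.
rewrite -(big_nat_widenl m 0 k xpredT (fun n => F (n - m)%N m)) //.
rewrite -{1}[nat_of_ord m]add0n big_addn.
by apply: eq_bigr => p _; rewrite addnK.
Qed.

End LogDerivative.

(** * The truncated tensor algebra *)

Identity Coercion fun_of_tensor : tensor >-> Funclass.

Section TruncatedTensorAlgebra.
Variables (d k : nat).

(** On raw tensors [tone] is not a unit, since [tmul] cuts off beyond level [k]. Bundling [inT]
    gives a genuine unital algebra to which the series identities apply. *)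
Record talg := Talg { tcoef :> tensor d; talgP : inT k tcoef }.

Lemma talg_ext (a b : talg) : (forall w, (size w <= k)%N -> a w = b w) -> a = b.
Proof.
case: a b => [a ha] [b hb] /= h; have eab : a = b.
  by apply/funext => w; case: (leqP (size w) k) => [/h//|kw]; rewrite ha ?hb.
by rewrite eab in ha *; congr Talg; apply: Prop_irrelevance.
Qed.

HB.instance Definition _ := gen_eqMixin talg.
HB.instance Definition _ := gen_choiceMixin talg.

Fact inT_tzero : inT k (@tzero d). Proof. by []. Qed.

Fact inT_tadd (a b : tensor d) : inT k a -> inT k b -> inT k (tadd a b).
Proof. by move=> ha hb w kw; rewrite /tadd ha ?hb ?addr0. Qed.

Fact inT_tscale c (a : tensor d) : inT k a -> inT k (tscale c a).
Proof. by move=> ha w kw; rewrite /tscale ha ?mulr0. Qed.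

Fact inT_tone : inT k (@tone d). Proof. by case. Qed.

Fact inT_tmul (a b : tensor d) : inT k (tmul k a b).
Proof. by move=> w kw; rewrite /tmul leqNgt kw. Qed.

Fact inT_tsub (a b : tensor d) : inT k a -> inT k b -> inT k (tsub a b).
Proof. by move=> ha hb; apply: inT_tadd => //; apply: inT_tscale. Qed.

Definition talg_zero := Talg inT_tzero.
Definition talg_add (a b : talg) := Talg (inT_tadd (talgP a) (talgP b)).
Definition talg_scale (c : R) (a : talg) := Talg (inT_tscale c (talgP a)).
Definition talg_opp (a : talg) := talg_scale (-1) a.
Definition talg_one := Talg inT_tone.
Definition talg_mul (a b : talg) := Talg (inT_tmul a b).

Fact talg_addA : associative talg_add.
Proof. by move=> a b c; apply: talg_ext => w _; apply: addrA. Qed.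
Fact talg_addC : commutative talg_add.
Proof. by move=> a b; apply: talg_ext => w _; apply: addrC. Qed.
Fact talg_add0 : left_id talg_zero talg_add.
Proof. by move=> a; apply: talg_ext => w _; apply: add0r. Qed.
Fact talg_addN : left_inverse talg_zero talg_opp talg_add.
Proof.
by move=> a; apply: talg_ext => w _; rewrite /= /tadd /tscale mulN1r addNr.
Qed.

HB.instance Definition _ :=
  GRing.isZmodule.Build talg talg_addA talg_addC talg_add0 talg_addN.

Lemma talg_addE (a b : talg) w : (a + b) w = a w + b w. Proof. by []. Qed.
Lemma talg_oppE (a : talg) w : (- a) w = - a w.
Proof. exact: mulN1r. Qed.
Lemma talg_sumE n (F : 'I_n -> talg) w : (\sum_(i < n) F i) w = \sum_(i < n) F i w.
Proof. by elim/big_rec2: _ => // i x y _ <-. Qed.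

Lemma tmulE (a b : tensor d) w : (size w <= k)%N ->
  tmul k a b w = \sum_(i < (size w).+1) a (take i w) * b (drop i w).
Proof. by rewrite /tmul => ->. Qed.

Fact talg_mulA : associative talg_mul.
Proof.
move=> a b c; apply: talg_ext => w kw; rewrite /= !tmulE //.
(* Both bracketings sum over the pairs of cut positions [i <= j] in [w]. *)
pose F (i j : nat) := a (take i w) * b (drop i (take j w)) * c (drop j w).
transitivity (\sum_(0 <= i < (size w).+1) \sum_(0 <= j < (size w).+1 | (i <= j)%N) F i j).
  rewrite big_mkord; apply: eq_bigr => i _.
  rewrite tmulE ?size_drop ?(leq_trans _ kw) ?leq_subr // mulr_sumr.
  rewrite -(big_nat_widenl i 0 (size w).+1 xpredT (F i)) //.
  have := big_addn 0 (size w).+1 i xpredT (F i); rewrite add0n => ->.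
  rewrite big_mkord subSn ?leq_ord //.
  by apply: eq_bigr => j _; rewrite /F take_drop mulrA drop_drop.
rewrite (exchange_big_dep xpredT) //= big_mkord; apply: eq_bigr => j _.
rewrite tmulE ?size_take_min ?(leq_trans (geq_minr _ _)) // mulr_suml.
rewrite (minn_idPl _) ?leq_ord // big_mkord.
rewrite (big_ord_widen (size w).+1 (fun i =>
  a (take i (take j w)) * b (drop i (take j w)) * c (drop j w))) ?ltn_ord //.
by apply: eq_big => [i|i ij]; rewrite ?ltnS // /F take_takel.
Qed.

Fact talg_mul1l : left_id talg_one talg_mul.
Proof.
move=> a; apply: talg_ext => w kw; rewrite /= tmulE // big_ord_recl big1 => [|i _].
  by rewrite take0 drop0 /tone eqxx mul1r addr0.
rewrite /tone -size_eq0 size_take_min /= /bump /=.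
by rewrite (minn_idPl _) ?ltn_ord // mul0r.
Qed.

Fact talg_mul1r : right_id talg_one talg_mul.
Proof.
move=> a; apply: talg_ext => w kw; rewrite /= tmulE // big_ord_recr big1 => [|i _] /=.
  by rewrite take_size drop_size /tone eqxx mulr1 add0r.
by rewrite /tone -size_eq0 size_drop subn_eq0 leqNgt ltn_ord /= mulr0.
Qed.

Fact talg_mulDl : left_distributive talg_mul talg_add.
Proof.
move=> a b c; apply: talg_ext => w kw; rewrite /= /tadd !tmulE // -big_split.
by apply: eq_bigr => i _; rewrite mulrDl.
Qed.

Fact talg_mulDr : right_distributive talg_mul talg_add.
Proof.
move=> a b c; apply: talg_ext => w kw; rewrite /= /tadd !tmulE // -big_split.
by apply: eq_bigr => i _; rewrite mulrDr.
Qed.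

Fact talg_one_neq0 : talg_one != 0.
Proof.
apply/eqP => /(congr1 (fun a : talg => a [::])); rewrite /= /tone /tzero /=.
by apply/eqP; rewrite oner_eq0.
Qed.

HB.instance Definition _ := GRing.Zmodule_isNzRing.Build talg
  talg_mulA talg_mul1l talg_mul1r talg_mulDl talg_mulDr talg_one_neq0.

Fact talg_scaleA a b v : talg_scale a (talg_scale b v) = talg_scale (a * b) v.
Proof. by apply: talg_ext => w _; apply: mulrA. Qed.
Fact talg_scale1 : left_id 1 talg_scale.
Proof. by move=> v; apply: talg_ext => w _; apply: mul1r. Qed.
Fact talg_scaleDr : right_distributive talg_scale +%R.
Proof. by move=> c a b; apply: talg_ext => w _; apply: mulrDr. Qed.
Fact talg_scaleDl v : {morph talg_scale^~ v : a b / a + b}.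
Proof. by move=> a b; apply: talg_ext => w _; apply: mulrDl. Qed.

HB.instance Definition _ := GRing.Zmodule_isLmodule.Build R talg
  talg_scaleA talg_scale1 talg_scaleDr talg_scaleDl.

Fact talg_scaleAl (c : R) (a b : talg) : c *: (a * b) = (c *: a) * b.
Proof.
apply: talg_ext => w kw; rewrite /= /tscale !tmulE // mulr_sumr.
by apply: eq_bigr => i _; rewrite mulrA.
Qed.
HB.instance Definition _ := GRing.Lmodule_isLalgebra.Build R talg talg_scaleAl.

Fact talg_scaleAr (c : R) (a b : talg) : c *: (a * b) = a * (c *: b).
Proof.
apply: talg_ext => w kw; rewrite /= /tscale !tmulE // mulr_sumr.
by apply: eq_bigr => i _; rewrite mulrCA.
Qed.
HB.instance Definition _ := GRing.Lalgebra_isAlgebra.Build R talg talg_scaleAr.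

Lemma talg_scaleE c (a : talg) w : (c *: a) w = c * a w. Proof. by []. Qed.
Lemma talg_mulE (a b : talg) : tcoef (a * b) = tmul k a b. Proof. by []. Qed.

Lemma tcoef_inj (a b : talg) : tcoef a = tcoef b -> a = b.
Proof. by move=> ab; apply: talg_ext => w _; rewrite ab. Qed.

Lemma tsub_talg (a b : talg) : tsub a b = a - b.
Proof. by []. Qed.

Lemma tpow_talg (a : talg) n : tpow k a n = a ^+ n.
Proof. by elim: n => [|n IH] //=; rewrite IH exprS. Qed.

Lemma texp_talg (a : talg) : texp k a = expt k a.
Proof.
apply/funext => w; rewrite /texp /tsum /expt talg_sumE.
by apply: eq_bigr => l _; rewrite tpow_talg.
Qed.

Lemma tlog_talg (a : talg) : tlog k a = logt k a.
Proof.
apply/funext => w; rewrite /tlog /tsum /logt talg_sumE.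
apply: eq_bigr => -[[|l] lk] _ /=; first by rewrite /tscale invr0 mulr0 mul0r.
by rewrite (tsub_talg a 1) -/(tpow k _ l.+1) tpow_talg.
Qed.

Lemma tinv_talg (a : talg) : tinv k a = invt k a.
Proof.
apply/funext => w; rewrite /tinv /tsum /invt talg_sumE.
by apply: eq_bigr => l _; rewrite (tsub_talg 1 a) tpow_talg.
Qed.

End TruncatedTensorAlgebra.

(** * The level filtration *)

Section Filtration.
Variables (d k : nat).
Local Notation T := (talg d k).
Implicit Types (a b z : T) (l m n : nat).

(** A decreasing filtration by two-sided ideals: [filt 1] is the augmentation ideal and [filt k.+1]
    is zero. *)
Definition filt l (z : T) : Prop := forall w, (size w < l)%N -> z w = 0.

Lemma filt0 l : filt l 0. Proof. by []. Qed.

Lemma filtD l a b : filt l a -> filt l b -> filt l (a + b).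
Proof. by move=> ha hb w lw; rewrite talg_addE ha ?hb ?addr0. Qed.

Lemma filtZ l c a : filt l a -> filt l (c *: a).
Proof. by move=> ha w lw; rewrite talg_scaleE ha ?mulr0. Qed.

Lemma filtN l a : filt l a -> filt l (- a).
Proof. by rewrite -scaleN1r; apply: filtZ. Qed.

Lemma filtB l a b : filt l a -> filt l b -> filt l (a - b).
Proof. by move=> ha hb; apply: filtD => //; apply: filtN. Qed.

Lemma filt_sum l n (F : 'I_n -> T) :
  (forall i, filt l (F i)) -> filt l (\sum_(i < n) F i).
Proof. by move=> h; apply: big_ind => //; apply: filtD. Qed.

Lemma filt_le l m a : (l <= m)%N -> filt m a -> filt l a.
Proof. by move=> lm h w lw; apply: h; apply: leq_trans lm. Qed.

Lemma filtM l m a b : filt l a -> filt m b -> filt (l + m) (a * b).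
Proof.
move=> ha hb w; rewrite talg_mulE /tmul; case: ifP => // _ lw.
rewrite big1 // => i _; case: (ltnP i l) => il.
  by rewrite ha ?mul0r // size_take_min (leq_ltn_trans (geq_minl _ _)).
rewrite hb ?mulr0 // size_drop ltn_subLR ?leq_ord //.
by apply: (leq_trans lw); rewrite leq_add2r.
Qed.

Lemma filtMl l a b : filt l b -> filt l (a * b).
Proof. by move=> h; apply: (@filtM 0). Qed.

Lemma filtMr l a b : filt l a -> filt l (a * b).
Proof. by move=> h; rewrite -[l]addn0; apply: filtM. Qed.

Lemma filtX a n : filt 1 a -> filt n (a ^+ n).
Proof. by move=> ha; elim: n => [//|n IH]; rewrite exprS -add1n; apply: filtM. Qed.

Lemma filt_eq0 l a : (k < l)%N -> filt l a -> a = 0.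
Proof. by move=> kl h; apply: talg_ext => w kw; apply: h; apply: leq_ltn_trans kl. Qed.

Lemma filt1_nilp a : filt 1 a -> a ^+ k.+1 = 0.
Proof. by move=> /filtX h; apply: (@filt_eq0 k.+1). Qed.

Lemma filt_ad l m a b : filt l a -> filt m b -> filt (l + m) (ad a b).
Proof. by move=> ha hb; apply: filtB; [|rewrite addnC]; apply: filtM. Qed.

Lemma filt_exprB l a b n : filt l (a - b) -> filt l (a ^+ n - b ^+ n).
Proof.
move=> h; elim: n => [|n IH]; first by rewrite subrr.
have -> : a ^+ n.+1 - b ^+ n.+1 = a * (a ^+ n - b ^+ n) + (a - b) * b ^+ n.
  by rewrite !exprS mulrBr mulrBl addrA subrK.
by apply: filtD; [apply: filtMl | apply: filtMr].
Qed.

Hypothesis k_gt0 : (0 < k)%N.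

(* On the augmentation ideal a power series [X + O(X^2)] is the identity to first order. *)
Lemma series_tangent (c : nat -> R) l a b : c 1%N = 1 ->
  filt 1 a -> filt 1 b -> filt l (a - b) ->
  filt l.+1 (\sum_(i < k.+1) c i *: a ^+ i - \sum_(i < k.+1) c i *: b ^+ i - (a - b)).
Proof.
move=> c1 ha hb hab; have k1 : (1 < k.+1)%N by [].
rewrite -sumrB (bigD1 (Ordinal k1)) //= c1 !scale1r !expr1 addrAC subrr add0r.
apply: big_ind => [||[[|[|i]] ik]] //; first exact: filtD.
- by rewrite !expr0 subrr.
move=> _ /=; rewrite -scalerBr; apply: filtZ.
have -> : a ^+ i.+2 - b ^+ i.+2 = a * (a ^+ i.+1 - b ^+ i.+1) + (a - b) * b ^+ i.+1.
  by rewrite !(exprS _ i.+1) mulrBr mulrBl addrA subrK.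
apply: filtD; first by rewrite -add1n; apply: filtM => //; apply: filt_exprB.
by rewrite -addn1 exprS; apply: filtM => //; apply: filtMr.
Qed.

Lemma expt_tangent l a b : filt 1 a -> filt 1 b -> filt l (a - b) ->
  filt l.+1 (expt k a - expt k b - (a - b)).
Proof.
by apply: (@series_tangent (fun i => i`!%:R^-1)); rewrite invr1.
Qed.

Lemma logt_tangent l a b : filt 1 (a - 1) -> filt 1 (b - 1) -> filt l (a - b) ->
  filt l.+1 (logt k a - logt k b - (a - b)).
Proof.
have -> : a - b = (a - 1) - (b - 1) by rewrite opprB addrA subrK.
by apply: (@series_tangent (fun i => (-1) ^+ i.+1 / i%:R)); rewrite invr1 mulr1 expr2 mulrNN mulr1.
Qed.

(** The remainder is [(a - a') (b - 1) + (a' - 1) (b - b')], and in each product one factor lies in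
    the augmentation ideal. *)
Lemma mul_tangent l a b a' b' : filt 1 (a' - 1) -> filt 1 (b - 1) ->
  filt l (a - a') -> filt l (b - b') ->
  filt l.+1 (a * b - a' * b' - ((a - a') + (b - b'))).
Proof.
move=> ha hb haa hbb.
have -> : a * b - a' * b' - ((a - a') + (b - b')) =
    (a - a') * (b - 1) + (a' - 1) * (b - b').
  rewrite !mulrBr !mulrBl !mulr1 !mul1r !opprD !opprK.
  by rewrite !addrA [RHS](ACl (2*5*1*7*3*4*6*8)%AC) /= addNr add0r.
apply: filtD; first by rewrite -addn1; apply: filtM.
by rewrite -add1n; apply: filtM.
Qed.

Lemma expt_sub1 z : filt 1 z -> filt 1 (expt k z - 1).
Proof.
move=> hz; have := @expt_tangent 1 z 0 hz (@filt0 1).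
rewrite subr0 expt0 => /(_ hz) /(filt_le (leqnSn _)) h.
by rewrite -[expt k z - 1](subrK z); apply: filtD.
Qed.

Lemma logt_filt1 s : filt 1 (s - 1) -> filt 1 (logt k s).
Proof.
move=> hs; have := @logt_tangent 1 s 1 hs; rewrite subrr logt1 subr0.
move=> /(_ (@filt0 1) hs) /(filt_le (leqnSn _)) h.
by rewrite -[logt k s](subrK (s - 1)); apply: filtD.
Qed.

(** If [a] and [b] agree below level [l] and have equal exponentials, [expt_tangent] makes them
    agree one level further; after [k+1] rounds they coincide. *)
Lemma expt_inj a b : filt 1 a -> filt 1 b -> expt k a = expt k b -> a = b.
Proof.
move=> ha hb eab; apply/eqP; rewrite -subr_eq0; apply/eqP.
apply: (@filt_eq0 k.+1) => //; elim: k.+1 => [//|l IH].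
have := expt_tangent ha hb IH; rewrite eab subrr sub0r => /filtN.
by rewrite opprK.
Qed.

Lemma exp_logt s : filt 1 (s - 1) -> expt k (logt k s) = s.
Proof. by move=> /filt1_nilp; apply: logtK. Qed.

(** Both sides have the same exponential by [exp_logt], so [expt_inj] applies. *)
Lemma log_expt z : filt 1 z -> logt k (expt k z) = z.
Proof.
move=> hz; apply: expt_inj => //; first exact/logt_filt1/expt_sub1.
by apply/exp_logt/expt_sub1.
Qed.

Lemma expt_mulN z : filt 1 z -> expt k z * expt k (- z) = 1.
Proof. by move=> /filt1_nilp; apply: exptN_mul. Qed.

Lemma exptN_mulV z : filt 1 z -> expt k (- z) * expt k z = 1.
Proof. by move=> /filtN /expt_mulN; rewrite opprK. Qed.

Lemma sub1_nilp s : filt 1 (s - 1) -> (1 - s) ^+ k.+1 = 0.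
Proof. by move=> /filtN; rewrite opprB => /filt1_nilp. Qed.

Lemma mul_invt s : filt 1 (s - 1) -> s * invt k s = 1.
Proof. by move=> /sub1_nilp /mulr_invt. Qed.

Lemma invt_mul s : filt 1 (s - 1) -> invt k s * s = 1.
Proof. by move=> /sub1_nilp /invt_mulr. Qed.

Lemma invt_expt z : filt 1 z -> invt k (expt k z) = expt k (- z).
Proof.
move=> hz; rewrite -[LHS]mulr1 -(expt_mulN hz) mulrA invt_mul ?mul1r //.
exact: expt_sub1.
Qed.

Lemma mul_sub1 a b : filt 1 (a - 1) -> filt 1 (b - 1) -> filt 1 (a * b - 1).
Proof.
move=> ha hb; rewrite -[a * b - 1](subrK (a - 1)); apply: filtD => //.
by rewrite opprB addrA subrK -{2}[a]mulr1 -mulrBr; apply: filtMl.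
Qed.

Lemma invt_sub1 s : filt 1 (s - 1) -> filt 1 (invt k s - 1).
Proof.
move=> hs; rewrite -{1}(invt_mul hs) -{1}[invt k s]mulr1 -mulrBr.
by apply: filtMl; rewrite -opprB; apply: filtN.
Qed.

Lemma invt_tangent l a b : filt 1 (a - 1) -> filt 1 (b - 1) -> filt l (a - b) ->
  filt l.+1 (invt k a - invt k b + (a - b)).
Proof.
move=> ha hb hab.
(* The resolvent identity; replacing both inverses by [1] changes only higher levels. *)
have e : invt k a - invt k b = - (invt k a * (a - b) * invt k b).
  by rewrite mulrBr invt_mul // mulrBl mul1r -mulrA mul_invt // mulr1 opprB.
have -> : invt k a - invt k b + (a - b) =
   - ((invt k a - 1) * (a - b) * invt k b + (a - b) * (invt k b - 1)).
  rewrite e; move: (a - b) (invt k a) (invt k b) => t x y.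
  by rewrite !mulrBl mulrBr mulr1 mul1r addrA subrK opprB addrC.
apply/filtN/filtD; first by rewrite -add1n -mulrA; apply: filtM; [apply: invt_sub1 | apply: filtMr].
by rewrite -addn1; apply: filtM => //; apply: invt_sub1.
Qed.

End Filtration.

(** * The free nilpotent Lie algebra and the closure of its exponential *)

Section Grading.
Variables (d k : nat).
Local Notation T := (talg d k).

Definition tgrade (z : tensor d) : tensor d := fun w => (size w)%:R * z w.

Fact inT_tgrade (z : T) : inT k (tgrade z).
Proof. by move=> w kw; rewrite /tgrade (talgP z) ?mulr0. Qed.

Definition grade (z : T) : T := Talg (inT_tgrade z).

Fact grade_linear : linear grade.
Proof.
move=> c a b; apply: talg_ext => w _; rewrite /= /tgrade /= /tadd /tscale; ring.
Qed.
HB.instance Definition _ := GRing.isLinear.Build R T T _ grade grade_linear.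

(** Cutting a word splits its length into the lengths of the two pieces. *)
Lemma gradeM (a b : T) : grade (a * b) = grade a * b + a * grade b.
Proof.
apply: talg_ext => w kw; rewrite /= /tgrade /tadd !tmulE // mulr_sumr -big_split.
apply: eq_bigr => i _ /=; rewrite -{1}[w](cat_take_drop i) size_cat natrD; ring.
Qed.

Lemma grade_ad (a b : T) : grade (ad a b) = ad (grade a) b + ad a (grade b).
Proof.
rewrite /ad linearB /= !gradeM opprD [RHS]addrACA.
by congr (_ + _); rewrite addrC.
Qed.

Lemma filt_grade l (z : T) : filt l z -> filt l (grade z).
Proof. by move=> h w lw; rewrite /= /tgrade h ?mulr0. Qed.

(* The operators [1 - grade / j] with [j = 1 .. k] compose to [0] on the
   augmentation ideal, so [grade] is inverted there by a polynomial in itself. *)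
Lemma grade_stable_inv (S : T -> Prop) (z : T) :
  (forall a b, S a -> S b -> S (a + b)) -> (forall c a, S a -> S (c *: a)) ->
  (forall a, S a -> S (grade a)) -> filt 1 z -> S (grade z) -> S z.
Proof.
move=> SD SZ Sg z1 Sz.
pose P := fix P n : T :=
  if n is n'.+1 then P n' - (n'.+1%:R^-1 : R) *: grade (P n') else z.
have SP n : S (grade (P n)).
  elim: n => [//|n IH] /=; rewrite linearB linearZ -scaleN1r /=.
  by apply: SD => //; apply/SZ/SZ/Sg.
have SzP n : S (z - P n).
  elim: n => [|n IH] /=; first by rewrite subrr -(scale0r (grade z)); apply: SZ.
  by rewrite opprB addrCA addrC; apply: SD => //; apply: SZ.
have P0 n w : (size w <= n)%N -> P n w = 0.
  elim: n w => [|n IH] w /=.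
    by move=> w0; apply: z1; rewrite ltnS.
  rewrite leq_eqVlt ltnS /tadd /= /tscale /= /tgrade => /orP[/eqP ->|/IH ->].
    by rewrite [X in _ + _ * X]mulrA mulVf ?pnatr_eq0 // mul1r mulN1r subrr.
  by rewrite !mulr0 addr0.
suff <- : z - P k = z by [].
by have -> : P k = 0 by [apply: talg_ext => w /P0]; rewrite subr0.
Qed.

(** [ad] with its arguments exchanged: for fixed [y] this is the inner derivation [z |-> [z, y]],
    packaged as a linear map. *)
Definition adr (y z : T) : T := ad z y.

Fact adr_linear y : linear (adr y).
Proof.
move=> c a b; rewrite /adr /ad mulrDl mulrDr -scalerAl -scalerAr scalerBr.
by rewrite opprD addrACA.
Qed.
HB.instance Definition _ y := GRing.isLinear.Build R T T _ (adr y) (adr_linear y).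

Lemma adrM y (a b : T) : adr y (a * b) = adr y a * b + a * adr y b.
Proof. by rewrite /adr /ad mulrBl mulrBr !mulrA [RHS]addrC addrA subrK. Qed.

End Grading.

Section FreeNilpotentLie.
Variables (d k : nat).
Hypothesis k_gt0 : (0 < k)%N.
Local Notation T := (talg d k).

(** The inclusion in [inT k] comes from minimality: [inT k] is itself a Lie subalgebra, and it
    contains the letters because they sit at level [1 <= k]. *)
Lemma in_g_lie : lie_subalgebra k (@in_g d k).
Proof.
split.
- move=> z; apply; last first.
    by move=> i w; rewrite /tbasis; case: eqP => // -> /=; rewrite ltnNge k_gt0.
  split => //; first exact: inT_tadd; first exact: inT_tscale.
  by move=> y z' _ _; apply: inT_tsub; apply: inT_tmul.
- by move=> S [].
- by move=> y z hy hz S hS hb; case: (hS) => _ _ h _ _; apply: h; [apply: hy|apply: hz].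
- by move=> c z hz S hS hb; case: (hS) => _ _ _ h _; apply: h; apply: hz.
- by move=> y z hy hz S hS hb; case: (hS) => _ _ _ _ h; apply: h; [apply: hy|apply: hz].
Qed.

Lemma in_g_inT (z : tensor d) : in_g k z -> inT k z.
Proof. by case: in_g_lie => h _ _ _ _; apply: h. Qed.

Lemma in_g_basis i : in_g k (@tbasis d i).
Proof. by move=> S _; apply. Qed.

Definition lieg (z : T) : Prop := in_g k z.

Lemma liegD (a b : T) : lieg a -> lieg b -> lieg (a + b).
Proof. by case: in_g_lie => _ _ h _ _; apply: h. Qed.

Lemma liegZ c (a : T) : lieg a -> lieg (c *: a).
Proof. by case: in_g_lie => _ _ _ h _; apply: h. Qed.

Lemma lieg0 : lieg 0.
Proof. by case: in_g_lie. Qed.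

Lemma liegN (a : T) : lieg a -> lieg (- a).
Proof. by rewrite -scaleN1r; apply: liegZ. Qed.

Lemma liegB (a b : T) : lieg a -> lieg b -> lieg (a - b).
Proof. by move=> ha hb; apply: liegD => //; apply: liegN. Qed.

Lemma lieg_ad (a b : T) : lieg a -> lieg b -> lieg (ad a b).
Proof. by case: in_g_lie => _ _ _ _ h; apply: h. Qed.

Lemma lieg_sum n (F : 'I_n -> T) : (forall i, lieg (F i)) -> lieg (\sum_(i < n) F i).
Proof. by move=> h; apply: big_ind => //; [apply: lieg0 | apply: liegD]. Qed.

Lemma lieg_filt1 (z : T) : lieg z -> filt 1 z.
Proof.
move=> hz; suff z0 : z [::] = 0 by case.
suff [] : inT k z /\ z [::] = 0 by [].
apply: (hz (fun z => inT k z /\ z [::] = 0)); last first.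
  by move=> i; split; [exact: (in_g_inT (@in_g_basis i)) | ].
split.
- by move=> ? [].
- by [].
- by move=> a b [ha a0] [hb b0]; split; [apply: inT_tadd | rewrite /tadd a0 b0 addr0].
- by move=> c a [ha a0]; split; [apply: inT_tscale | rewrite /tscale a0 mulr0].
- move=> a b [ha a0] [hb b0]; split; first by apply: inT_tsub; apply: inT_tmul.
  by rewrite /tbracket /tsub /tadd /topp /tscale !tmulE //= !big_ord1 /= a0 b0 !mul0r mulr0 addr0.
Qed.

(** Minimality again: the Lie elements whose [grade] is a Lie element form a Lie subalgebra by the
    Leibniz rule for brackets, and [grade] fixes the letters. *)
Lemma lieg_grade (z : T) : lieg z -> lieg (grade z).
Proof.
move=> hz.
suff [] : in_g k z /\ in_g k (tgrade z) by [].
have [_ g0 gD gZ gB] := in_g_lie.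
apply: (hz (fun z => in_g k z /\ in_g k (tgrade z))); last first.
  move=> i; split; first exact: in_g_basis.
  have -> : tgrade (tbasis i) = tbasis i; last exact: in_g_basis.
  apply/funext => w; rewrite /tgrade /tbasis; case: eqP => [->|_]; last by rewrite mulr0.
  by rewrite mulr1.
split.
- by move=> a [] /in_g_inT.
- by split => //; rewrite (_ : tgrade _ = @tzero d) //; apply/funext => w; rewrite /tgrade mulr0.
- move=> a b [ha a0] [hb b0]; split; first exact: gD.
  rewrite (_ : tgrade _ = tadd (tgrade a) (tgrade b)); first exact: gD.
  by apply/funext => w; rewrite /tgrade /tadd mulrDr.
- move=> c a [ha a0]; split; first exact: gZ.
  rewrite (_ : tgrade _ = tscale c (tgrade a)); first exact: gZ.
  by apply/funext => w; rewrite /tgrade /tscale mulrCA.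
- move=> a b [ha a0] [hb b0]; split; first exact: gB.
  pose a' := Talg (in_g_inT ha); pose b' := Talg (in_g_inT hb).
  suff : lieg (grade (ad a' b')) by [].
  by rewrite grade_ad; apply: liegD; apply: lieg_ad.
Qed.

Lemma lieg_iter_ad m (a b : T) : lieg a -> lieg b -> lieg (iter m (ad a) b).
Proof. by move=> ha hb; elim: m => //= m IH; apply: lieg_ad. Qed.

Lemma filt_iter_ad m l (a b : T) : filt 1 a -> filt l b -> filt (m + l) (iter m (ad a) b).
Proof. by move=> ha hb; elim: m => //= m IH; rewrite addSn -add1n; apply: filt_ad. Qed.

(** The term [z ^+ p * ad_z^m (D z)] starts at level [p + m + 1], hence vanishes once
    [k <= p + m]. *)
Lemma derivation_expt_filt (D : {linear T -> T}) (z : T) :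
  (forall a b, D (a * b) = D a * b + a * D b) -> filt 1 z -> filt 1 (D z) ->
  expt k (- z) * D (expt k z) =
    \sum_(m < k) ((-1) ^+ m / m.+1`!%:R : R) *: iter m (ad z) (D z).
Proof.
move=> DM z1 Dz1; rewrite (derivation_expt DM) => [|p m kpm].
  by rewrite mulrA exptN_mulV // mul1r.
apply: (@filt_eq0 _ _ (p + (m + 1))); first by rewrite addnA addn1 ltnS.
by apply: filtM; [apply: filtX | apply: filt_iter_ad].
Qed.

Lemma lieg_logder (z : T) : lieg z -> lieg (expt k (- z) * grade (expt k z)).
Proof.
move=> hz; have z1 := lieg_filt1 hz.
rewrite (derivation_expt_filt (@gradeM d k)) //; last exact: filt_grade.
by apply: lieg_sum => m; apply: liegZ; apply: lieg_iter_ad => //; apply: lieg_grade.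
Qed.

(** For the inner derivation [D u = [u, y]] the logarithmic derivative [exp(-b) D(exp b)] equals
    [y - exp(-b) y exp b], and it is a sum of iterated brackets. *)
Lemma lieg_conj (b y : T) : lieg b -> lieg y -> lieg (expt k (- b) * y * expt k b).
Proof.
move=> hb hy; have b1 := lieg_filt1 hb.
have := derivation_expt_filt (@adrM d k y) b1 (lieg_filt1 (lieg_ad hb hy)).
rewrite /= {1}/adr /ad mulrBr !mulrA exptN_mulV // mul1r => e.
rewrite -[X in lieg X]opprK -[X in lieg (- X)](addKr y) e opprD opprK.
apply: liegB => //; apply: lieg_sum => m; apply: liegZ; apply: lieg_iter_ad => //.
exact: lieg_ad.
Qed.

(** Approximate membership for inductions on the level; at [l = k.+1] it is [lieg] itself. *)
Definition lieg_mod l (z : T) : Prop := exists2 y, lieg y & filt l (z - y).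

Lemma lieg_modD l (a b : T) : lieg_mod l a -> lieg_mod l b -> lieg_mod l (a + b).
Proof.
move=> [a' ga fa] [b' gb fb]; exists (a' + b'); first exact: liegD.
by rewrite opprD addrACA; apply: filtD.
Qed.

Lemma lieg_modZ l c (a : T) : lieg_mod l a -> lieg_mod l (c *: a).
Proof.
by move=> [a' ga fa]; exists (c *: a'); [apply: liegZ | rewrite -scalerBr; apply: filtZ].
Qed.

Lemma lieg_mod_grade l (a : T) : lieg_mod l a -> lieg_mod l (grade a).
Proof.
move=> [a' ga fa]; exists (grade a'); first exact: lieg_grade.
by rewrite -linearB; apply: filt_grade.
Qed.

Lemma lieg_mod_lieg l (a : T) : lieg a -> lieg_mod l a.
Proof. by move=> ga; exists a => //; rewrite subrr. Qed.

(** One level is gained because [a] and the Lie approximation of [b] both lack a constant term. *)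
Lemma lieg_mod_ad l (a b : T) : filt 1 a -> lieg_mod l a -> lieg_mod l b ->
  lieg_mod l.+1 (ad a b).
Proof.
move=> a1 [a' ga fa] [b' gb fb]; exists (ad a' b'); first exact: lieg_ad.
have -> : ad a b - ad a' b' = ad a (b - b') + ad (a - a') b'.
  rewrite /ad !mulrBr !mulrBl.
  by rewrite !opprD !opprK !addrA [RHS](ACl (2*5*4*7*1*3*6*8)%AC) /= addNr add0r subrr add0r.
apply: filtD; first by rewrite -add1n; apply: filt_ad.
by rewrite -addn1; apply: filt_ad => //; apply: lieg_filt1.
Qed.

(* [grade Z] equals the logarithmic derivative of [exp Z] up to iterated brackets with [Z],
   which are known one level higher than [Z] itself. *)
Lemma lieg_of_logder (Z : T) : filt 1 Z ->
  lieg (expt k (- Z) * grade (expt k Z)) -> lieg Z.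
Proof.
move=> Z1; rewrite (derivation_expt_filt (@gradeM d k)) //; last exact: filt_grade.
set W := (X in lieg X) => hW.
suff [y gy /(filt_eq0 (ltnSn _)) /eqP] : lieg_mod k.+1 Z.
  by rewrite subr_eq0 => /eqP ->.
have: (0 < k.+1)%N by [].
elim: k.+1 => [//|[_ _|l /(_ isT) IH _]].
  by exists 0; [apply: lieg0 | rewrite subr0].
(* [grade] can be inverted within [lieg_mod l.+2], so it suffices to treat [grade Z]. *)
apply: (@grade_stable_inv _ _ (lieg_mod l.+2)) => //.
- exact: lieg_modD.
- exact: lieg_modZ.
- exact: lieg_mod_grade.
have eW : W = grade Z + \sum_(m < k | m != Ordinal k_gt0)
    ((-1) ^+ m / m.+1`!%:R : R) *: iter m (ad Z) (grade Z).
  by rewrite /W (bigD1 (Ordinal k_gt0)) //= expr0 invr1 mulr1 scale1r.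
have -> : grade Z = W - (W - grade Z) by rewrite opprB addrC subrK.
apply: lieg_modD; first exact: lieg_mod_lieg.
rewrite -scaleN1r; apply: lieg_modZ; rewrite eW addrAC subrr add0r.
apply: big_ind => [||[[|m] mk]] //; first by apply: lieg_mod_lieg; apply: lieg0.
  exact: lieg_modD.
(* Every remaining term has an outer bracket with [Z], which lifts the known level [l.+1] to
   [l.+2]. *)
move=> _ /=; apply: lieg_modZ; apply: lieg_mod_ad => //.
elim: m {mk} => [|m IHm] /=; first exact: lieg_mod_grade.
case: (lieg_mod_ad Z1 IH IHm) => y gy fy; exists y => //.
exact: filt_le fy.
Qed.

(** A qualitative Baker-Campbell-Hausdorff theorem. The logarithmic derivative of [exp a exp b] is
    that of [exp a] conjugated by [exp b], plus that of [exp b]; both are Lie elements, and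
    [lieg_of_logder] returns to the logarithm. *)
Lemma expt_mul_lieg (a b : T) : lieg a -> lieg b ->
  exists2 c, lieg c & expt k a * expt k b = expt k c.
Proof.
move=> ha hb; have [a1 b1] := (lieg_filt1 ha, lieg_filt1 hb).
have ab1 := mul_sub1 (expt_sub1 k_gt0 a1) (expt_sub1 k_gt0 b1).
set Z := logt k (expt k a * expt k b).
have eZ : expt k Z = expt k a * expt k b by apply: exp_logt.
exists Z => //; apply: lieg_of_logder; first exact: logt_filt1.
have -> : expt k (- Z) = expt k (- b) * expt k (- a).
  rewrite -(invt_expt k_gt0 (logt_filt1 k_gt0 ab1)).
  rewrite eZ -[RHS]mul1r -(invt_mul ab1) -!mulrA.
  by rewrite (mulrA (expt k b)) expt_mulN // mul1r expt_mulN // mulr1.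
rewrite eZ gradeM mulrDr; apply: liegD.
  rewrite !mulrA -[X in lieg (X * _)]mulrA; apply: lieg_conj => //.
  exact: lieg_logder.
rewrite -mulrA (mulrA (expt k (- a))) exptN_mulV // mul1r.
exact: lieg_logder.
Qed.

End FreeNilpotentLie.

(** * Existence and uniqueness of barycenters *)

Section Barycenter.
Variables (d k N : nat).
Hypotheses (k_gt0 : (0 < k)%N) (N_gt0 : (0 < N)%N).
Local Notation T := (talg d k).
Implicit Types (m s : T) (x : 'I_N -> T).

Definition grp (s : T) : Prop := exists2 z, lieg z & s = expt k z.

Lemma grp_expt z : lieg z -> grp (expt k z).
Proof. by move=> hz; exists z. Qed.

Lemma grp1 : grp 1.
Proof. by rewrite -(@expt0 _ T k); apply: grp_expt; apply: lieg0. Qed.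

Lemma grpM s m : grp s -> grp m -> grp (s * m).
Proof.
move=> [a ha ->] [b hb ->]; have [c hc ->] := expt_mul_lieg k_gt0 ha hb.
exact: grp_expt.
Qed.

Lemma grp_sub1 s : grp s -> filt 1 (s - 1).
Proof. by move=> [a /(lieg_filt1 k_gt0) ha ->]; apply: expt_sub1. Qed.

Lemma grpV s : grp s -> grp (invt k s).
Proof.
move=> [a ha ->]; rewrite invt_expt //; last exact: lieg_filt1.
by apply: grp_expt; apply: liegN.
Qed.

Lemma lieg_logt s : grp s -> lieg (logt k s).
Proof. by move=> [a ha ->]; rewrite log_expt //; apply: lieg_filt1. Qed.

Definition logsum x m : T := \sum_(i < N) logt k (invt k m * x i).

Definition bary_step x m : T := m * expt k ((N%:R^-1 : R) *: logsum x m).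

Lemma lieg_logsum x m : (forall i, grp (x i)) -> grp m -> lieg (logsum x m).
Proof.
move=> hx hm; apply: lieg_sum => // i; apply: lieg_logt.
by apply: grpM => //; apply: grpV.
Qed.

Lemma grp_bary_step x m : (forall i, grp (x i)) -> grp m -> grp (bary_step x m).
Proof.
by move=> hx hm; apply: grpM => //; apply: grp_expt; apply: liegZ => //; apply: lieg_logsum.
Qed.

(** With [t = m - m'], the inverse, its product with [x i], the logarithm, the mean and the
    exponential each change by [- t] up to level [l.+1]. Multiplication by [m] adds [t], and the two
    cancel. *)
Lemma bary_step_contracts x m m' l : (forall i, grp (x i)) -> grp m -> grp m' ->
  filt l (m - m') -> filt l.+1 (bary_step x m - bary_step x m').
Proof.
move=> hx hm hm' hl; set t := m - m'.
have m1 := grp_sub1 hm; have m1' := grp_sub1 hm'.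
(* A change equal to [- t] up to level [l.+1] still has level [l], as the next tangent lemma
   requires. *)
have tl a : filt l.+1 (a + t) -> filt l a.
  by move=> /(filt_le (leqnSn _)) h; rewrite -(addrK t a); apply: filtB.
have hlog i : filt l.+1 (logt k (invt k m * x i) - logt k (invt k m' * x i) + t).
  have hi := invt_tangent m1 m1' hl.
  have hu : filt l.+1 (invt k m * x i - invt k m' * x i + t).
    have := mul_tangent (invt_sub1 m1') (grp_sub1 (hx i)) (tl _ hi) (b' := x i).
    rewrite subrr addr0 => /(_ (@filt0 _ _ _)) h.
    rewrite -[_ + t](subrK (invt k m - invt k m' + t)); apply: filtD => //.
    by rewrite opprD addrACA subrr addr0.
  have g1 a : grp a -> filt 1 (invt k a * x i - 1).
    by move=> ha; apply: grp_sub1; apply: grpM => //; apply: grpV.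
  have h := logt_tangent k_gt0 (g1 _ hm) (g1 _ hm') (tl _ hu).
  by rewrite -[X in X + t](subrK (invt k m * x i - invt k m' * x i)) -addrA; apply: filtD.
pose S a := (N%:R^-1 : R) *: logsum x a.
have S1 a : grp a -> filt 1 (S a).
  by move=> ha; apply: filtZ; apply: lieg_filt1 => //; apply: lieg_logsum.
have hS : filt l.+1 (S m - S m' + t).
  have -> : S m - S m' + t = (N%:R^-1 : R) *:
      \sum_(i < N) (logt k (invt k m * x i) - logt k (invt k m' * x i) + t).
    rewrite big_split /= sumrB sumr_const card_ord scalerDr scalerBr.
    rewrite -scaler_nat scalerA mulVf ?scale1r //.
    by rewrite pnatr_eq0 -lt0n.
  by apply: filtZ; apply: filt_sum.
have he : filt l.+1 (expt k (S m) - expt k (S m') + t).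
  have h := expt_tangent k_gt0 (S1 _ hm) (S1 _ hm') (tl _ hS).
  by rewrite -[X in X + t](subrK (S m - S m')) -addrA; apply: filtD.
have := mul_tangent m1' (expt_sub1 k_gt0 (S1 _ hm)) hl (tl _ he).
move=> h; rewrite /bary_step -/(S m) -/(S m').
rewrite -[X in filt _ X](subrK (t + (expt k (S m) - expt k (S m')))).
by apply: filtD => //; rewrite addrC.
Qed.

Lemma bary_step_fixP x m : (forall i, grp (x i)) -> grp m ->
  bary_step x m = m <-> logsum x m = 0.
Proof.
move=> hx hm; rewrite /bary_step; split=> [e|->]; last first.
  by rewrite scaler0 expt0 mulr1.
have g := lieg_logsum hx hm.
have : (N%:R^-1 : R) *: logsum x m = 0.
  apply: (expt_inj k_gt0) => //.
    by apply: filtZ; apply: lieg_filt1.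
  rewrite expt0 -[LHS]mul1r -(invt_mul (grp_sub1 hm)) -mulrA e.
  by rewrite invt_mul //; apply: grp_sub1.
move/eqP; rewrite scaler_eq0 invr_eq0 pnatr_eq0 -leqn0 leqNgt N_gt0 /=.
by move/eqP.
Qed.

Lemma logsum0_uniq x m m' : (forall i, grp (x i)) -> grp m -> grp m' ->
  logsum x m = 0 -> logsum x m' = 0 -> m = m'.
Proof.
move=> hx hm hm' /bary_step_fixP fm /bary_step_fixP fm'.
apply/eqP; rewrite -subr_eq0; apply/eqP/(@filt_eq0 _ _ k.+1) => //.
elim: k.+1 => [//|l IH]; rewrite -fm // -fm' //; exact: bary_step_contracts.
Qed.

Definition bary_pt x : T := iter k.+1 (bary_step x) 1.

Lemma grp_iter_step x n : (forall i, grp (x i)) -> grp (iter n (bary_step x) 1).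
Proof.
by move=> hx; elim: n => [|n IH] /=; [apply: grp1 | apply: grp_bary_step].
Qed.

(** Iterates [n] and [n+1] agree below level [n], vacuously at the start, so the iteration is
    stationary from step [k+1] on. *)
Lemma logsum_bary_pt x : (forall i, grp (x i)) -> logsum x (bary_pt x) = 0.
Proof.
move=> hx; apply/bary_step_fixP => //; first exact: grp_iter_step.
apply/eqP; rewrite -subr_eq0; apply/eqP/(@filt_eq0 _ _ k.+1) => //; rewrite /bary_pt.
elim: k.+1 => [//|n IH]; apply: bary_step_contracts => //.
  exact: (@grp_iter_step x n.+1).
exact: grp_iter_step.
Qed.

(** * Transfer from bundled elements to raw tensors *)

Lemma in_GP (s : tensor d) : in_G k s <-> exists2 a : T, grp a & s = a.
Proof.
split=> [[z [hz ->]]|[a [z hz ->] ->]].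
  exists (expt k (Talg (in_g_inT k_gt0 hz))); first exact: grp_expt.
  by rewrite -texp_talg.
by exists z; split=> //; rewrite texp_talg.
Qed.

Lemma in_G_talg (a : T) : in_G k a <-> grp a.
Proof. by split=> [/in_GP[b gb /tcoef_inj ->]|ga] //; apply/in_GP; exists a. Qed.

Lemma in_GN_talg (x : 'I_N -> tensor d) : in_GN k x ->
  exists2 x' : 'I_N -> T, (forall i, grp (x' i)) & x = (fun i => tcoef (x' i)).
Proof.
move=> hx; have hT i : inT k (x i) by case/in_GP: (hx i) => a _ ->; apply: talgP.
exists (fun i => Talg (hT i)) => [i|]; first by apply/in_G_talg/hx.
exact/funext.
Qed.

Lemma logsum_talg x m :
  (fun w => \sum_(i < N) tlog k (tmul k (tinv k m) (x i)) w) = logsum x m.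
Proof.
apply/funext => w; rewrite /logsum talg_sumE; apply: eq_bigr => i _.
by rewrite tinv_talg -talg_mulE tlog_talg.
Qed.

Lemma is_baryP x m : is_bary k x m <-> grp m /\ logsum x m = 0.
Proof.
rewrite /is_bary logsum_talg; split=> [[/in_G_talg gm /(@tcoef_inj _ _ _ 0) e]|[gm ->]] //.
by split=> //; apply/in_G_talg.
Qed.

(** A solution [m] makes the choice operator return a barycenter, and uniqueness identifies it with
    [m]. *)
Lemma bary_eq x m : (forall i, grp (x i)) -> grp m -> logsum x m = 0 ->
  bary k (fun i => tcoef (x i)) = m.
Proof.
move=> hx hm m0; have hb : is_bary k x m by apply/is_baryP.
have := ClassicalEpsilon.epsilon_spec (inhabits (@tzero d)) _ (ex_intro _ _ hb).
rewrite -/(bary k _); set b := bary _ _ => hb'.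
have [b' gb' eb] : exists2 b' : T, grp b' & b = b' by case: hb' => /in_GP.
move: hb'; rewrite eb => /is_baryP[_ b0].
by rewrite (@logsum0_uniq x b' m).
Qed.

Lemma baryE x : (forall i, grp (x i)) -> bary k (fun i => tcoef (x i)) = bary_pt x.
Proof.
by move=> hx; apply: bary_eq => //; [apply: grp_iter_step | apply: logsum_bary_pt].
Qed.

(** [bary_step] on raw tensors: a polynomial map has to be given by a formula on the whole ambient
    space. *)
Definition tensor_step (x : 'I_N -> tensor d) (m : tensor d) : tensor d :=
  tmul k m (texp k (tscale N%:R^-1
    (fun w => \sum_(i < N) tlog k (tmul k (tinv k m) (x i)) w))).

Lemma tensor_step_talg x m : tensor_step (fun i => tcoef (x i)) m = bary_step x m.
Proof. by rewrite /tensor_step logsum_talg (texp_talg (_ *: logsum x m)). Qed.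

Lemma bary_iter (x : 'I_N -> tensor d) : in_GN k x ->
  bary k x = iter k.+1 (tensor_step x) (@tone d).
Proof.
move=> /in_GN_talg[x' hx ->]; rewrite baryE // /bary_pt.
by elim: k.+1 => [//|n IH]; rewrite !iterS -tensor_step_talg IH.
Qed.

Lemma in_G_bary (x : 'I_N -> tensor d) : in_GN k x -> in_G k (bary k x).
Proof.
move=> /in_GN_talg[x' hx ->]; rewrite baryE //; apply/in_G_talg.
exact: grp_iter_step.
Qed.

End Barycenter.

(** * Polynomial maps *)

Section PolynomialMaps.
Variables (d k : nat) (X : Type) (C : (X -> R) -> Prop).
Implicit Types F G : X -> tensor d.

Definition polymap F : Prop :=
  forall w, (size w <= k)%N -> polyfun C (fun x => F x w).

Lemma polyfun_sum n (f : 'I_n -> X -> R) :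
  (forall i, polyfun C (f i)) -> polyfun C (fun x => \sum_(i < n) f i x).
Proof.
elim: n f => [|n IH] f hf.
  by under eq_fun do rewrite big_ord0; apply: pf_const.
under eq_fun do rewrite big_ord_recr.
by apply: (@pf_add _ C (fun x => \sum_(i < n) _)) => //; apply: IH.
Qed.

Lemma polymap_const a : polymap (fun _ => a).
Proof. by move=> w _; apply: pf_const. Qed.

Lemma polymap_add F G : polymap F -> polymap G -> polymap (fun x => tadd (F x) (G x)).
Proof. by move=> hF hG w kw; apply: pf_add; [apply: hF | apply: hG]. Qed.

Lemma polymap_scale c F : polymap F -> polymap (fun x => tscale c (F x)).
Proof. by move=> hF w kw; apply: (pf_mul (pf_const C c)); apply: hF. Qed.

Lemma polymap_sub F G : polymap F -> polymap G -> polymap (fun x => tsub (F x) (G x)).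
Proof. by move=> hF hG; apply: polymap_add => //; apply: polymap_scale. Qed.

Lemma polymap_mul F G : polymap F -> polymap G -> polymap (fun x => tmul k (F x) (G x)).
Proof.
move=> hF hG w kw; under eq_fun do rewrite tmulE //.
apply: polyfun_sum => i; apply: pf_mul; [apply: hF | apply: hG].
  by rewrite size_take_min (leq_trans (geq_minr _ _)).
by rewrite size_drop (leq_trans (leq_subr _ _)).
Qed.

Lemma polymap_pow F n : polymap F -> polymap (fun x => tpow k (F x) n).
Proof.
by move=> hF; elim: n => [|n IH]; [apply: polymap_const | apply: polymap_mul].
Qed.

Lemma polymap_sum n (F : X -> 'I_n -> tensor d) :
  (forall i, polymap (F^~ i)) -> polymap (fun x w => \sum_(i < n) F x i w).
Proof. by move=> hF w kw; apply: polyfun_sum => i; apply: hF. Qed.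

Lemma polymap_exp F : polymap F -> polymap (fun x => texp k (F x)).
Proof.
move=> hF; apply: (@polymap_sum _ (fun x (l : 'I_k.+1) => tscale l`!%:R^-1 (tpow k (F x) l))).
by move=> l; apply: polymap_scale; apply: polymap_pow.
Qed.

Lemma polymap_inv F : polymap F -> polymap (fun x => tinv k (F x)).
Proof.
move=> hF; apply: (@polymap_sum _ (fun x (l : 'I_k.+1) => tpow k (tsub (@tone d) (F x)) l)).
by move=> l; apply: polymap_pow; apply: polymap_sub => //; apply: polymap_const.
Qed.

Lemma polymap_log F : polymap F -> polymap (fun x => tlog k (F x)).
Proof.
move=> hF; apply: (@polymap_sum _ (fun x (l : 'I_k.+1) => if l == 0%N :> nat then @tzero d
  else tscale ((-1) ^+ l.+1 / l%:R) (tpow k (tsub (F x) (@tone d)) l))).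
case=> -[|l] lk; first exact: polymap_const.
by apply: polymap_scale; apply: (@polymap_pow _ l.+1); apply: polymap_sub => //;
  apply: polymap_const.
Qed.

Lemma polymap_iter_step N n (G : X -> 'I_N -> tensor d) :
  (forall i, polymap (G^~ i)) ->
  polymap (fun x => iter n (tensor_step k (G x)) (@tone d)).
Proof.
move=> hG; elim: n => [|n IH]; first exact: polymap_const.
apply: polymap_mul => //; apply: polymap_exp; apply: polymap_scale.
apply: polymap_sum => i; apply: polymap_log; apply: polymap_mul => //.
exact: polymap_inv.
Qed.

Lemma morphism_on_polymap (D : X -> Prop) (E : tensor d -> Prop) F G :
  (forall x, D x -> E (F x)) -> (forall x, D x -> F x = G x) -> polymap G ->
  morphism_on k C D E F.
Proof.
move=> DE FG hG; split=> // w kw; exists (fun x => G x w); split; first exact: hG.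
by move=> x /FG ->.
Qed.

(** The sample is a polynomial function [G] of a parameter, which covers both the full map and the
    map in one remaining element. *)
Lemma morphism_on_bary N (D : X -> Prop) (G : X -> 'I_N -> tensor d) :
  (0 < k)%N -> (0 < N)%N -> (forall x, D x -> in_GN k (G x)) ->
  (forall i, polymap (G^~ i)) ->
  morphism_on k C D (in_G k) (fun x => bary k (G x)).
Proof.
move=> k_gt0 N_gt0 DG hG; apply: morphism_on_polymap (polymap_iter_step k.+1 hG).
  by move=> x /DG; apply: in_G_bary.
by move=> x /DG; apply: bary_iter.
Qed.

End PolynomialMaps.

(** * Morphism, surjectivity, and inversion in one sample element *)

Theorem theorem4p7 (d k N : nat) (hd : (0 < d)%N) (hk : (0 < k)%N) (hN : (0 < N)%N) :
  (* bary : G^N -> G is a morphism of real affine varieties ... *)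
  @morphism_on d k _ (@coordTN d k N) (@in_GN d k N) (@in_G d k) (@bary d k N)
  (* ... which is surjective *)
  /\ (forall m : tensor d, @in_G d k m ->
        exists x : 'I_N -> tensor d, @in_GN d k N x /\ @bary d k N x = m)
  (* fixing all sample elements except the j-th gives an isomorphism G -> G *)
  /\ (forall (j : 'I_N) (y : 'I_N -> tensor d),
        (forall i, i != j -> @in_G d k (y i)) ->
        let phi := fun g : tensor d =>
                     @bary d k N (fun i => if i == j then g else y i) in
        @morphism_on d k _ (@coordT d k) (@in_G d k) (@in_G d k) phi /\
        exists psi : tensor d -> tensor d,
          [/\ @morphism_on d k _ (@coordT d k) (@in_G d k) (@in_G d k) psi,
              forall g, @in_G d k g -> psi (phi g) = g &
              forall g, @in_G d k g -> phi (psi g) = g]).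
Proof.
split; [|split].
- apply: (@morphism_on_bary _ _ _ _ _ _ (fun x : 'I_N -> tensor d => x)) => // i w kw.
  by apply: pf_coord; exists i, w.
(* The constant sample at [m] has barycenter [m]. *)
- move=> m /(in_GP hk)[m' gm ->]; exists (fun _ => tcoef m'); split.
    by move=> i; apply/in_G_talg.
  apply: (bary_eq hk hN (x := fun _ => m')) => //.
  rewrite /logsum big1 // => i _.
  by rewrite invt_mul ?logt1 //; apply: grp_sub1.
move=> j y hy phi.
(* Nothing is assumed of [y j], so the unit takes its place before the sample is bundled. *)
have [y' gy' yy'] : exists2 y' : 'I_N -> talg d k,
    forall i, grp (y' i) & forall i, i != j -> y i = y' i.
  have [|y' gy' e] := @in_GN_talg d k N hk (fun i => if i == j then @tone d else y i).
    move=> i; case: eqP => [_|/eqP]; last exact: hy.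
    by apply/(in_GP hk); exists 1 => //; apply: grp1.
  exists y' => // i ij; have := congr1 (@^~ i) e.
  by rewrite (negbTE ij).
pose sample (g : talg d k) i := if i == j then g else y' i.
have gsample g : grp g -> forall i, grp (sample g i).
  by move=> gg i; rewrite /sample; case: ifP.
have phiE (g : talg d k) : phi g = bary k (fun i => tcoef (sample g i)).
  by congr bary; apply/funext => i; rewrite /sample; case: eqP => // /eqP /yy'.
have in_phi g : in_G k g -> in_G k (phi g).
  move=> /(in_GP hk)[g' gg ->]; rewrite phiE; apply: in_G_bary => // i.
  by apply/in_G_talg => //; apply: gsample.
split.
  apply: morphism_on_bary => // [g gg i|i]; first by case: eqP => // /eqP; apply: hy.
  case: eqP => _; last exact: polymap_const.
  by move=> w kw; apply: pf_coord; exists w.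
pose rest (m : talg d k) := \sum_(i < N | i != j) logt k (invt k m * y' i).
have logsumE g m : logsum (sample g) m = logt k (invt k m * g) + rest m.
  rewrite /logsum (bigD1 j) //= /sample eqxx; congr (_ + _).
  by apply: eq_bigr => i /negbTE ->.
have grest m : grp m -> lieg (rest m).
  move=> gm; apply: big_ind => [||i _]; [exact: lieg0 | exact: liegD |].
  by apply: lieg_logt => //; apply: grpM => //; apply: grpV.
(* The barycenter equation [log (m^-1 g) + rest m = 0] solved for [g]. *)
pose psi (m : tensor d) : tensor d := tmul k m (texp k (tscale (-1) (fun w =>
  \sum_(i < N) (if i == j then @tzero d else tlog k (tmul k (tinv k m) (y i))) w))).
have psiE (m : talg d k) : psi m = m * expt k (- rest m).
  rewrite talg_mulE -texp_talg; congr (tmul k m (texp k _)).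
  apply/funext => w; rewrite talg_oppE /tscale mulN1r; congr (- _).
  rewrite /rest [in RHS]big_mkcond talg_sumE; apply: eq_bigr => i _.
  case: eqP => //= /eqP ij.
  by rewrite tinv_talg yy' // -talg_mulE tlog_talg.
have gpsi (m : talg d k) : grp m -> grp (m * expt k (- rest m)).
  by move=> gm; apply: grpM => //; apply: grp_expt; apply: liegN => //; apply: grest.
exists psi; split.
- apply: morphism_on_polymap (fun _ _ => erefl) _.
    by move=> m /(in_GP hk)[m' gm ->]; rewrite psiE; apply/in_G_talg => //; apply: gpsi.
  have pid : polymap k (@coordT d k) id by move=> w kw; apply: pf_coord; exists w.
  apply: polymap_mul => //; apply: polymap_exp; apply: polymap_scale.
  apply: polymap_sum => i; case: eqP => _; first exact: polymap_const.
  apply: polymap_log; apply: polymap_mul; last exact: polymap_const.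
  exact: polymap_inv.
- move=> g /(in_GP hk)[g' gg ->]; rewrite phiE baryE //; last exact: gsample.
  set m := bary_pt _; have gm : grp m by apply: grp_iter_step => //; apply: gsample.
  rewrite psiE; congr tcoef.
  have := logsum_bary_pt hk hN (gsample _ gg); rewrite -/m logsumE.
  (* At the barycenter [- rest m = log (m^-1 g)], so [psi m = m (m^-1 g) = g]. *)
  move/eqP; rewrite addr_eq0 => /eqP <-.
  rewrite exp_logt; first by rewrite mulrA mul_invt ?mul1r //; apply: grp_sub1.
  by apply: grp_sub1 => //; apply: grpM => //; apply: grpV.
- move=> m /(in_GP hk)[m' gm ->]; rewrite psiE phiE.
  (* By uniqueness it suffices that [m'] solves the equation of the sample containing [psi m']. *)
  apply: bary_eq => //; first exact/gsample/gpsi.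
  rewrite logsumE mulrA invt_mul ?mul1r; last exact: grp_sub1.
  by rewrite log_expt ?addNr //; apply: lieg_filt1 => //; apply: liegN => //; apply: grest.
Qed.
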